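(* Let $p$ be a prime number and let \[T(p):=\frac{1}{5}\left( (1+\sqrt{5}) \left( \frac{3+\sqrt{5}}{2} \right)^{2p}+(1-\sqrt{5}) \left( \frac{3-\sqrt{5}}{2} \right)^{2p}+3\right),\] which is an integer. Then: (1) if $p \equiv 1 \pmod{5}$, then $T(p)$ is divisible by $5$; (2) if $p \equiv 3 \pmod{5}$, then $T(p)$ is divisible by $11$; (3) if $p \equiv 2 \pmod{15}$, then $T(p)$ is divisible by $31$. *)

(* Defs.v *)
From mathcomp Require Import all_boot all_order all_algebra.

Set Implicit Arguments.
Unset Strict Implicit.
Unset Printing Implicit Defensive.

Import Order.TTheory GRing.Theory Num.Theory.
Local Open Scope ring_scope.

Definition T (R : rcfType) (p : nat) : R :=
  1 / 5 * ((1 + Num.sqrt 5) * ((3 + Num.sqrt 5) / 2) ^+ (2 * p)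
           + (1 - Num.sqrt 5) * ((3 - Num.sqrt 5) / 2) ^+ (2 * p)
           + 3).

(* Main.v *)
(** Both $((3 \pm \sqrt 5)/2)^2$ are roots of $X^2 - 7X + 1$, so
    $T(0) = 1$, $T(1) = 5$ and $T(n+2) = 7T(n+1) - T(n) - 3$. This recurrence
    is periodic of period 5 modulo 5 and modulo 11, and of period 15 modulo 31;
    moreover $T(1) = 5$, $T(2) = 31$ and $T(3) = 11 \cdot 19$. *)
Require Import Defs.
From mathcomp Require Import all_boot all_order all_algebra ring.

Set Implicit Arguments.
Unset Strict Implicit.
Unset Printing Implicit Defensive.

Import Order.TTheory GRing.Theory Num.Theory.
Local Open Scope ring_scope.

Definition rec_step (A : pzRingType) (u : A * A) : A * A :=
  (u.2, 7 * u.2 - u.1 - 3).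

(* The pair (T n, T n.+1), in an arbitrary ring so that it can be computed
   in ['F_q]: unary [int] is too slow for the period 15. *)
Definition rec_pair (A : pzRingType) (n : nat) : A * A :=
  iter n (@rec_step A) (1, 5).

Lemma rec_pair_intr (A : pzRingType) (n : nat) :
  rec_pair A n = ((rec_pair int n).1%:~R, (rec_pair int n).2%:~R).
Proof.
rewrite /rec_pair; elim: n => [|n IHn] //=.
by rewrite IHn /rec_step /= !rmorphB rmorphM.
Qed.

(** The [- 3] makes the constant summand [3 / 5] a fixed point: [c = 7 * c - c - 3]. *)
Lemma T_rec (R : rcfType) (n : nat) : T R n.+2 = 7 * T R n.+1 - T R n - 3.
Proof.
have root (c : R) : c ^+ 2 = 5 ->
    (((3 + c) / 2) ^+ 2) ^+ 2 = 7 * ((3 + c) / 2) ^+ 2 - 1.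
  move=> c2; have -> : ((3 + c) / 2) ^+ 2 = (7 + 3 * c) / 2.
    by transitivity ((9 + 6 * c + c ^+ 2) / 4); [field | rewrite c2; field].
  transitivity ((49 + 42 * c + 9 * c ^+ 2) / 4); first by field.
  by rewrite c2; field.
have s2 : Num.sqrt 5 ^+ 2 = 5 :> R by rewrite sqr_sqrtr ?ler0n.
have := root _ s2; have := root (- Num.sqrt 5); rewrite sqrrN => /(_ s2) {s2}.
rewrite /T !exprM; move: (Num.sqrt 5) => s.
(* Only the quadratic relations of [a] and [b] matter from here: the identity holds for arbitrary
   [s]. *)
move: (((3 + s) / 2) ^+ 2) (((3 - s) / 2) ^+ 2) => a b b2 a2.
by rewrite -(addn2 n) !exprD a2 b2 !exprS; field.
Qed.

Lemma T_intr (R : rcfType) (n : nat) : T R n = (rec_pair int n).1%:~R.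
Proof.
suff: (T R n, T R n.+1) = rec_pair R n by rewrite rec_pair_intr; case.
elim: n => [|n IHn]; last first.
  by rewrite /rec_pair iterS -/(rec_pair R n) -IHn /rec_step T_rec.
have s2 : Num.sqrt 5 ^+ 2 = 5 :> R by rewrite sqr_sqrtr ?ler0n.
rewrite /rec_pair /T /= !expr0; congr (_, _); first by field.
(* The summands are conjugate, so odd powers of [Num.sqrt 5] cancel. *)
transitivity ((15 + 7 * Num.sqrt 5 ^+ 2) / 10 : R); first by field.
by rewrite s2; field.
Qed.

(** Once the initial pair recurs after [N] steps, whole blocks of [N] steps leave it fixed. *)
Lemma rec_pair_mod (A : pzRingType) (N n : nat) :
  rec_pair A N = (1, 5) -> rec_pair A n = rec_pair A (n %% N).
Proof.
move=> per; rewrite {1}(divn_eq n N) addnC /rec_pair iterD iterM.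
by rewrite (iter_fix _ per).
Qed.

Lemma rec_pair_dvdz (q N r n : nat) :
    prime q -> rec_pair 'F_q N = (1, 5) -> (rec_pair 'F_q (r %% N)).1 = 0 ->
  n = r %[mod N] -> (q %| (rec_pair int n).1)%Z.
Proof.
move=> q_pr per r0 nr.
have /(congr1 fst)/= := rec_pair_intr 'F_q n.
rewrite (rec_pair_mod n per) nr r0 => /esym/eqP.
by rewrite -(dvdz_pcharf (pchar_Fp q_pr)).
Qed.

Theorem theorem2 (R : rcfType) (p : nat) (p_prime : prime p) :
  exists t : int,
    [/\ T R p = t%:~R,
        p = 1 %[mod 5] -> (5 %| t)%Z,
        p = 3 %[mod 5] -> (11 %| t)%Z
      & p = 2 %[mod 15] -> (31 %| t)%Z].
Proof.
exists (rec_pair int p).1; split; first exact: T_intr.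
(* In each case the period and the zero at the residue are evaluated in ['F_q]. *)
all: by apply: rec_pair_dvdz => //; apply/eqP; vm_compute.
Qed.
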